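(* Let $A$ be a unital $\ast$-algebra and let $M$ be a finitely generated projective left $A$-module, with $d\in\mathbb{N}$ and an idempotent $\rho\in\mathrm{End}(A^d)$ such that $M\cong\rho(A^d)=A^d\cdot\rho_\beta$ as left $A$-modules. If $\rho_\beta=\rho_\beta^\dagger$, then every left $A$-module endomorphism $C$ of $M$ is $A$-adjointable with respect to the Hermitian structure on $M$ induced by $(-,-)^d_{\mathrm{L}}$ (that is, the restriction of $(-,-)^d_{\mathrm{L}}$ to $\rho(A^d)$, transported to $M$ by the isomorphism $M\cong\rho(A^d)$).
   Context: $\ast$-algebras are complex, associative and unital, with antilinear, antimultiplicative involution $\ast$. The canonical Hermitian structure on the free left $A$-module $A^d$ is $(\overline{x},\overline{y})^d_{\mathrm{L}}=\sum_{i=1}^d x_i\,y_i^\ast$. $\mathrm{End}(A^d)$ is the set of left $A$-module endomorphisms of $A^d$; each $C\in\mathrm{End}(A^d)$ has a matrix $C_\beta\in M_d(A)$ with respect to the canonical basis $\beta$, determined by $C(\overline{x})=\overline{x}\cdot C_\beta$ (row vector times matrix). For a matrix $C_\beta$, $C_\beta^\dagger$ is its conjugate transpose: $(C_\beta^\dagger)_{ij}=(C_{ji})^\ast$. A left $A$-module endomorphism $C$ of a left $A$-module $M$ with Hermitian structure $(-,-):M\times M\to A$ is $A$-adjointable if there is a left $A$-module endomorphism $C^\star$ of $M$ with $(C(x),y)=(x,C^\star(y))$ for all $x,y\in M$. *)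

(* Defs.v *)
From HB Require Import structures.
From mathcomp Require Import all_boot all_order all_algebra.
From mathcomp Require Import complex.
From mathcomp Require Import classical_sets functions reals.

Set Implicit Arguments.
Unset Strict Implicit.
Unset Printing Implicit Defensive.

Import GRing.Theory.

Local Open Scope ring_scope.

(* The complex algebra structure is spelled out on a [pzRingType] because
   [algType] is built on nontrivial rings, which would exclude the zero
   algebra. *)
HB.mixin Record isStarAlgebra (R : realType) A of GRing.PzRing A := {
  cscale : R[i] -> A -> A;
  cscaleDl : forall (k l : R[i]) (x : A),
    cscale (k + l) x = cscale k x + cscale l x;
  cscaleDr : forall (k : R[i]) (x y : A),
    cscale k (x + y) = cscale k x + cscale k y;
  cscaleA : forall (k l : R[i]) (x : A), cscale k (cscale l x) = cscale (k * l) x;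
  cscale1 : forall x : A, cscale 1 x = x;
  cscaleAl : forall (k : R[i]) (x y : A), cscale k (x * y) = cscale k x * y;
  cscaleAr : forall (k : R[i]) (x y : A), cscale k (x * y) = x * cscale k y;
  star : A -> A;
  starD : forall x y : A, star (x + y) = star x + star y;
  starZ : forall (k : R[i]) (x : A), star (cscale k x) = cscale (conjc k) (star x);
  starM : forall x y : A, star (x * y) = star y * star x;
  starK : forall x : A, star (star x) = x
}.

#[short(type="starAlgType")]
HB.structure Definition StarAlgebra (R : realType) :=
  {A of GRing.PzRing A & isStarAlgebra R A}.

Section Modules.
Variable A : pzRingType.

Definition finitely_generated (M : lmodType A) : Prop :=
  exists (n : nat) (g : 'I_n -> M),
    forall m : M, exists a : 'I_n -> A, m = \sum_(i < n) a i *: g i.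

Definition projective (M : lmodType A) : Prop :=
  forall (N P : lmodType A) (g : {linear N -> P}) (f : {linear M -> P}),
    (forall p : P, exists n : N, g n = p) ->
    exists h : {linear M -> N}, forall m : M, g (h m) = f m.

Definition adjointable (M : lmodType A) (herm : M -> M -> A)
    (C : {linear M -> M}) : Prop :=
  exists Cstar : {linear M -> M},
    forall x y : M, herm (C x) y = herm x (Cstar y).

(* [phi] is an isomorphism of left modules from [M] onto the submodule
   [rho (A^d)] of the module [A^d] of row vectors. *)
Definition iso_onto_image (M : lmodType A) (d : nat)
    (rho : {linear 'rV[A]_d -> 'rV[A]_d}) (phi : {linear M -> 'rV[A]_d}) :
  Prop := set_bij [set: M] (range rho) phi.

End Modules.

Section Hermitian.
Variables (R : realType) (A : starAlgType R).

Definition canonical_herm (d : nat) (x y : 'rV[A]_d) : A :=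
  \sum_(i < d) x 0 i * star (y 0 i).

Definition induced_herm (M : lmodType A) (d : nat)
    (phi : {linear M -> 'rV[A]_d}) (x y : M) : A :=
  canonical_herm (phi x) (phi y).

Definition dagger (d : nat) (C : 'M[A]_d) : 'M[A]_d :=
  \matrix_(i, j) star (C j i).

End Hermitian.

(* Main.v *)
Require Import Defs.
From HB Require Import structures.
From mathcomp Require Import all_boot all_order all_algebra.
From mathcomp Require Import complex.
From mathcomp Require Import classical_sets functions reals.

Import GRing.Theory.

(** Endomorphisms of the free module [A^d] are matrices, and the dagger of a
    matrix is its adjoint for the canonical Hermitian structure.  An
    endomorphism [C] of [M] extends to [A^d]: when [phi] identifies [M] with
    the image of the idempotent [rho], the projection [rho] corestricts to a
    linear [psi : A^d -> M] with [phi \o psi = rho] and [psi \o phi = id]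
    ([retraction_onto_image]), and [phi \o C \o psi] has some matrix [B].
    The adjoint of [C] is then the compression [psi \o B^dagger \o phi]:
    since [rho] is self-adjoint and fixes the image of [phi],
    [[
      (phi x, phi (psi (phi y B^dagger))) = (phi x, rho (phi y B^dagger))
        = (rho (phi x), phi y B^dagger) = (phi x, phi y B^dagger)
        = (phi x B, phi y) = (phi (C x), phi y).
    ]]
    Self-adjointness of [rho] is what makes the compression by [psi] harmless
    in the second argument of the Hermitian structure. *)

Section Star.
Local Open Scope ring_scope.
Variables (R : realType) (A : starAlgType R).

Lemma star0 : star (0 : A) = 0.
Proof. by apply: (addrI (star 0)); rewrite -starD !addr0. Qed.

Lemma star_sum (I : Type) (r : seq I) (F : I -> A) :
  star (\sum_(i <- r) F i) = \sum_(i <- r) star (F i).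
Proof. exact: (big_morph _ (@starD R A) star0). Qed.

(** Both sides are the double sum of the terms
    [x_j * B_ji * star y_i]; the two reversals of order, by [star] of a product
    and by the transpose, cancel, so that [A] may be noncommutative. *)
Lemma canonical_herm_dagger (d : nat) (B : 'M[A]_d) (x y : 'rV[A]_d) :
  canonical_herm (x *m B) y = canonical_herm x (y *m dagger B).
Proof.
rewrite /canonical_herm.
under eq_bigr do rewrite mxE mulr_suml.
rewrite exchange_big /=; apply: eq_bigr => j _.
rewrite mxE star_sum mulr_sumr; apply: eq_bigr => i _.
by rewrite mxE starM starK mulrA.
Qed.

End Star.

Section Retraction.
Local Open Scope ring_scope.
Local Open Scope classical_set_scope.

Lemma idempotent_fixes_image {A : pzRingType} {M : lmodType A} {d : nat}
    {rho : {linear 'rV[A]_d -> 'rV[A]_d}} {phi : {linear M -> 'rV[A]_d}} :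
  (forall x, rho (rho x) = rho x) -> iso_onto_image rho phi ->
  forall m, rho (phi m) = phi m.
Proof.
move=> rho_idem [phi_img _ _] m.
by have [v _ <-] := phi_img m I; rewrite rho_idem.
Qed.

(** The values of [psi] are chosen as preimages under [phi]; linearity of the
    choice is forced by the injectivity of [phi]. *)
Lemma retraction_onto_image {A : pzRingType} {M : lmodType A} {d : nat}
    {rho : {linear 'rV[A]_d -> 'rV[A]_d}} {phi : {linear M -> 'rV[A]_d}} :
  (forall x, rho (rho x) = rho x) -> iso_onto_image rho phi ->
  exists psi : {linear 'rV[A]_d -> M},
    (forall v, phi (psi v) = rho v) /\ (forall m, psi (phi m) = m).
Proof.
move=> rho_idem phi_iso; case: (phi_iso) => _ phi_inj phi_surj.
have phiI (m n : M) : phi m = phi n -> m = n by apply: phi_inj; rewrite inE.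
have pre v : exists m, phi m = rho v.
  by have [|m _ mE] := phi_surj (rho v); [exists v | exists m].
have [f fE] := boolp.choice pre.
have f_lin : linear f.
  by move=> a u v; apply: phiI; rewrite linearP !fE linearP.
pose fL := GRing.isLinear.Build A _ M _ f f_lin.
pose psi : {linear 'rV[A]_d -> M} := HB.pack f fL.
exists psi; split=> [//|m].
by apply: phiI; rewrite fE (idempotent_fixes_image rho_idem phi_iso).
Qed.

End Retraction.

(* [lin1_mx f] is the matrix of [f] acting on row vectors: f x = x *m lin1_mx f *)
Theorem proposition6p2 (R : realType) (A : starAlgType R) (M : lmodType A)
    (d : nat) (rho : {linear 'rV[A]_d -> 'rV[A]_d})
    (phi : {linear M -> 'rV[A]_d}) :
  finitely_generated M ->
  projective M ->
  (forall x : 'rV[A]_d, rho (rho x) = rho x) ->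
  iso_onto_image rho phi ->
  lin1_mx rho = dagger (lin1_mx rho) ->
  forall C : {linear M -> M}, adjointable (induced_herm phi) C.
Proof.
move=> _ _ rho_idem phi_iso rho_sa C.
have [psi [phi_psi psi_phi]] := retraction_onto_image rho_idem phi_iso.
pose B := lin1_mx (phi \o C \o psi).
exists (psi \o mulmxr (dagger B) \o phi) => x y.
rewrite /induced_herm /= phi_psi -mul_rV_lin1 rho_sa.
rewrite -!canonical_herm_dagger !mul_rV_lin1 /=.
by rewrite (idempotent_fixes_image rho_idem phi_iso) psi_phi.
Qed.
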